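(* Let $X$ be a complex Banach space, let $T \in L(X)$ and let $\Psi=(\Psi_1,\Psi_2)$ be a spectral a-partitioning function for $T$. If $\Phi=(\Phi_1,\Phi_2)$ is a spectral valued function such that $\Psi \leq \Phi$, then $\Phi$ is a spectral partitioning function for $T$ if and only if $\Phi_2(T) \setminus \Psi_2(T) = (\Psi_1(T) \setminus \Phi_1(T)) \bigsqcup (\sigma(T)\setminus \sigma_a(T))$.
   Context: $L(X)$ is the Banach algebra of bounded linear operators on $X$; $\sigma(T)$ is the spectrum and $\sigma_a(T)$ the approximate point spectrum of $T$; $\mathcal{P}(\mathbb{C})$ is the set of all subsets of $\mathbb{C}$. The symbol $\bigsqcup$ denotes disjoint union: $A = B \bigsqcup C$ means $A = B\cup C$ and $B\cap C=\emptyset$. A spectral valued function is a function $\Phi=(\Phi_1,\Phi_2): L(X)\to \mathcal{P}(\mathbb{C})\times\mathcal{P}(\mathbb{C})$ such that for every $S\in L(X)$, $\Phi_1(S)\subset\sigma(S)$ and $\Phi_2(S)\subset\sigma(S)$. A spectral valued function $\Phi$ is a spectral partitioning function for $T\in L(X)$ if $\sigma(T)=\Phi_1(T)\bigsqcup\Phi_2(T)$, and a spectral a-partitioning function for $T$ if $\sigma_a(T)=\Phi_1(T)\bigsqcup\Phi_2(T)$. For spectral valued functions $\Psi,\Phi$, write $\Psi\leq\Phi$ if for all $S\in L(X)$, $\Phi_1(S)\subset\Psi_1(S)$ and $\Psi_2(S)\subset\Phi_2(S)$. *)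

(* Defs.v *)
From HB Require Import structures.
From mathcomp Require Import all_boot all_order all_algebra.
From mathcomp Require Import all_classical all_reals all_analysis.
From mathcomp.real_closed Require Import complex.

Set Implicit Arguments.
Unset Strict Implicit.
Unset Printing Implicit Defensive.

Import Order.TTheory GRing.Theory Num.Theory.
Import numFieldNormedType.Exports.
Local Open Scope classical_set_scope.
Local Open Scope ring_scope.
Local Open Scope complex_scope.

Section BoundedOperators.
Context {R : realType}.
Implicit Type X : completeNormedModType R[i].

(* The norm of X is R[i]-valued but always real and nonnegative, and z <= w in
   R[i] means that w - z is a nonnegative real.  Hence, unless X is zero, a
   bound M as below is necessarily real and nonnegative. *)
Record bounded_operator X := BoundedOperator {
  linear_part :> {linear X -> X};
  operator_bounded : exists M : R[i], forall x : X,
    `|linear_part x| <= M * `|x|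
}.

(* Leibniz equality in L(X) is equality of maps. *)
Lemma bounded_operatorP X (S T : bounded_operator X) : S =1 T -> S = T.
Proof.
case: S T => [[S cS] bS] [[T cT] bT] /= /funext eST.
rewrite /= in cS cT bS bT eST *.
subst T; case: cS bS => -[cS1] [cS2] bS; case: cT bT => -[cT1] [cT2] bT.
rewrite (Prop_irrelevance cT1 cS1) in bT *.
rewrite (Prop_irrelevance cT2 cS2) in bT *.
by rewrite (Prop_irrelevance bT bS).
Qed.

Lemma id_bounded X : exists M : R[i], forall x : X,
  `|(idfun : {linear X -> X}) x| <= M * `|x|.
Proof. by exists 1 => x; rewrite mul1r. Qed.

Definition id_operator X : bounded_operator X := BoundedOperator (id_bounded X).

Lemma bounded_ge0 X (S : bounded_operator X) :
  exists2 M : R[i], 0 <= M & forall x : X, `|S x| <= M * `|x|.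
Proof.
case: (operator_bounded S) => M SM.
have [[x x0]|X0] := pselect (exists x : X, x != 0).
  exists M => //; have := le_trans (normr_ge0 _) (SM x).
  by rewrite pmulr_lge0 // normr_gt0.
exists 0 => // x; have [->|x0] := eqVneq x 0; last by case: X0; exists x.
by rewrite linear0 normr0 mulr0.
Qed.

Lemma comp_bounded X (S T : bounded_operator X) : exists M : R[i],
  forall x : X, `|(S \o T : {linear X -> X}) x| <= M * `|x|.
Proof.
have [M M0 SM] := bounded_ge0 S; have [N _ TN] := bounded_ge0 T.
exists (M * N) => x /=; apply: (le_trans (SM _)).
by rewrite -mulrA ler_wpM2l.
Qed.

Definition comp_operator X (S T : bounded_operator X) : bounded_operator X :=
  BoundedOperator (comp_bounded S T).

Lemma shift_bounded X (T : bounded_operator X) (l : R[i]) : exists M : R[i],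
  forall x : X,
  `|(T \- l \*: (idfun : {linear X -> X}) : {linear X -> X}) x| <= M * `|x|.
Proof.
have [M _ TM] := bounded_ge0 T; exists (M + `|l|) => x /=.
by rewrite (le_trans (ler_normB _ _))// normrZ mulrDl lerD2r.
Qed.

(* T - l I *)
Definition shift_operator X (T : bounded_operator X) (l : R[i]) :
  bounded_operator X := BoundedOperator (shift_bounded T l).

Definition invertible_operator X (T : bounded_operator X) : Prop :=
  exists S : bounded_operator X,
    comp_operator S T = id_operator X /\ comp_operator T S = id_operator X.

Definition spectrum X (T : bounded_operator X) : set R[i] :=
  [set l | ~ invertible_operator (shift_operator T l)].

Definition approximate_point_spectrum X (T : bounded_operator X) : set R[i] :=
  [set l | exists u : nat -> X,
    (forall n, `|u n| = 1) /\ shift_operator T l (u n) @[n --> \oo] --> 0].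

Definition disjoint_union {U : Type} (A B C : set U) : Prop :=
  A = B `|` C /\ B `&` C = set0.

Record spectral_valued X := SpectralValued {
  spectral_fun :> bounded_operator X -> set R[i] * set R[i];
  spectral_fun1 : forall S, (spectral_fun S).1 `<=` spectrum S;
  spectral_fun2 : forall S, (spectral_fun S).2 `<=` spectrum S
}.

Definition spectral_partitioning X (Phi : spectral_valued X)
    (T : bounded_operator X) : Prop :=
  disjoint_union (spectrum T) (Phi T).1 (Phi T).2.

Definition spectral_a_partitioning X (Phi : spectral_valued X)
    (T : bounded_operator X) : Prop :=
  disjoint_union (approximate_point_spectrum T) (Phi T).1 (Phi T).2.

Definition spectral_le X (Psi Phi : spectral_valued X) : Prop :=
  forall S, (Phi S).1 `<=` (Psi S).1 /\ (Psi S).2 `<=` (Phi S).2.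

End BoundedOperators.

(* Main.v *)
Require Import Defs.
From HB Require Import structures.
From mathcomp Require Import all_boot all_order all_algebra.
From mathcomp Require Import all_classical all_reals all_analysis.
From mathcomp.real_closed Require Import complex.

Local Open Scope classical_set_scope.
Local Open Scope ring_scope.
Local Open Scope complex_scope.

(** The claim is pure set theory ([disjoint_union_refine]). Since F1 ⊆ P1 ⊆ A ⊆ S, the set S \ F1 is
    the disjoint union of P2, P1 \ F1 and S \ A. As F2 ⊆ S, the pair F1, F2 partitions S iff F2 = S
    \ F1; removing P2, contained in both sides, gives the stated equation. *)

Lemma disjoint_unionP {U : Type} (A B C : set U) :
  disjoint_union A B C <->
  forall x, (A x <-> B x \/ C x) /\ ~ (B x /\ C x).
Proof.
split=> [[-> BC0] x|ABC].
  by split=> // BCx; have : (B `&` C) x by []; rewrite BC0.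
split; apply/seteqP; split=> x.
- by move=> /(ABC x).1.
- by move=> /(ABC x).1.
- by move=> /(ABC x).2.
- by [].
Qed.

Lemma disjoint_union_refine {U : Type} (S A P1 P2 F1 F2 : set U) :
  A `<=` S -> F2 `<=` S -> F1 `<=` P1 -> P2 `<=` F2 ->
  disjoint_union A P1 P2 ->
  disjoint_union S F1 F2 <-> disjoint_union (F2 `\` P2) (P1 `\` F1) (S `\` A).
Proof.
move=> AS FS FP PF /disjoint_unionP AP.
(* At a fixed point only propositional logic remains. [tauto] is intuitionistic, hence the instances
   of [EM]; with the partition of [A] they also decide membership in [P1] and [P2]. *)
by split=> /disjoint_unionP H; apply/disjoint_unionP => x;
  move: (AS x) (FS x) (FP x) (PF x) (AP x) (H x) (EM (A x)) (EM (F1 x))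
    => /=; tauto.
Qed.

(* The approximate point spectrum lies in the spectrum because the spectral
   valued function Psi partitions it. *)
Theorem corollary4p2 (R : realType) (X : completeNormedModType R[i])
    (T : bounded_operator X) (Psi Phi : spectral_valued X) :
  spectral_a_partitioning Psi T ->
  spectral_le Psi Phi ->
  spectral_partitioning Phi T <->
  disjoint_union ((Phi T).2 `\` (Psi T).2)
    ((Psi T).1 `\` (Phi T).1)
    (spectrum T `\` approximate_point_spectrum T).
Proof.
move=> aPsi /(_ T)[le1 le2]; apply: disjoint_union_refine => //.
- by case: aPsi => -> _ x [/spectral_fun1|/spectral_fun2].
- exact: spectral_fun2.
Qed.
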